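(* For every compact set $K\subset\mathbb{C}$ such that $\mathbb{C}\setminus K$ is connected, $$\{z\in K:\ \text{there exists a bounded approximate identity for } M_z\}=\partial K.$$
   Context: $A(K)$ is the uniform algebra (with the sup norm on $K$) of all complex-valued functions continuous on $K$ and holomorphic on $\mathrm{int}(K)$; $\partial K$ is the topological boundary of $K$ in $\mathbb{C}$. For $z\in K$, $M_z=\{f\in A(K): f(z)=0\}$, regarded as a commutative normed algebra under the sup norm. A bounded approximate identity for a commutative normed algebra $A$ is a net $\{e_\alpha\}_{\alpha\in I}\subset A$ such that, for some $k>0$, $\|e_\alpha\|\le k$ for all $\alpha\in I$, and $\lim_\alpha xe_\alpha=x$ for every $x\in A$. *)

(* Defs.v *)
From mathcomp Require Import all_boot all_order all_algebra.
From mathcomp Require Import all_classical all_reals all_analysis.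
From mathcomp Require Import complex.

Set Implicit Arguments.
Unset Strict Implicit.
Unset Printing Implicit Defensive.

Import Order.TTheory GRing.Theory Num.Theory.
Import numFieldNormedType.Exports.

Local Open Scope classical_set_scope.
Local Open Scope ring_scope.
Local Open Scope complex_scope.

(* [R[i]] as a numeric field: MathComp-Analysis gives every [numFieldType] the
   topology of its norm, here the modulus, and makes it a normed module over
   itself, so [derivable] on [Cplx R] is complex differentiability. *)
Definition Cplx (R : realType) : numFieldType := R[i].

Definition boundary (T : topologicalType) (A : set T) : set T :=
  closure A `\` A°.

Section normed_algebra.

(* Normed algebras need not be unital: [A] is the carrier, a
   subset of the ambient ring [V], normed by the restriction of [N] to [A]. *)
Variables (R : realType) (V : pzRingType) (N : V -> R) (A : set V).

Definition directed_preorder (I : Type) (le : I -> I -> Prop) : Prop :=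
  [/\ inhabited I,
      forall i, le i i,
      forall i j k, le i j -> le j k -> le i k
    & forall i j, exists k, le i k /\ le j k].

Definition net_norm_cvg (I : Type) (le : I -> I -> Prop) (u : I -> V) (l : V)
    : Prop :=
  forall eps : R, 0 < eps -> exists i0, forall i, le i0 i -> N (u i - l) < eps.

Definition bounded_approximate_identity
    (I : Type) (le : I -> I -> Prop) (e : I -> V) : Prop :=
  [/\ directed_preorder le,
      forall i, A (e i),
      exists2 k : R, 0 < k & forall i, N (e i) <= k
    & forall x, A x -> net_norm_cvg le (fun i => x * e i) x].

Definition has_bounded_approximate_identity : Prop :=
  exists (I : Type) (le : I -> I -> Prop) (e : I -> V),
    bounded_approximate_identity le e.

End normed_algebra.

Section uniform_algebra.

Variables (R : realType) (K : set (Cplx R)).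

Definition sup_norm (f : Cplx R -> Cplx R) : R :=
  sup [set ComplexField.Normc.normc (f z) | z in K].

(* A function on [K] is represented by its extension by zero to the plane, so
   that equality in [uniform_algebra] is equality on [K].  The extension affects
   neither continuity within [K] nor differentiability at interior points. *)
Definition uniform_algebra : set (Cplx R -> Cplx R) :=
  [set f | [/\ {within K, continuous f},
               forall z, K° z -> derivable f z 1
             & forall z, ~ K z -> f z = 0]].

Definition vanishing_ideal (z : Cplx R) : set (Cplx R -> Cplx R) :=
  [set f | uniform_algebra f /\ f z = 0].

End uniform_algebra.

(* Main.v *)
(* Interior points. Suppose e lies in M_z and (w - z) e is uniformly close to w - z, where z
   is interior. Then F(w) = e(w)^2 / (w - z) is complex differentiable on a square centred at
   z, including z because e vanishes there, so its circulation is zero by Goursat's theorem;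
   but on the boundary of the square F is close to 1 / (w - z), whose circulation is not.

   Boundary points. Fix r > 0 and p outside K with |p - z| < r / 4. Since the complement of K
   is connected, p can be joined outside K, inside the disc of radius r, to a point q with
   |q - z| >= r / 2; multiplying principal square roots along the way yields a holomorphic
   branch s of sqrt ((w - p) / (w - q)) on K with s(oo) = 1. As s(w)^2 determines w, a value
   s(w) close to -1 would force w to be far away, where Re s > 0; so |1 + s| is bounded below
   by an absolute constant. Hence
     e_r(w) = 4 (w - z) / ((w - q) (1 + s(w))^2) = 4 (w - z) (1 - s) / ((1 + s) (p - q))
   vanishes at z, is bounded by an absolute constant, and is 1 + O(r / |w - z|) away from z.
   The functions e_r, as r tends to 0, form the bounded approximate identity. *)

Require Import Defs.
From mathcomp Require Import all_boot all_order all_algebra.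
From mathcomp Require Import all_classical all_reals all_analysis.
From mathcomp Require Import complex ring lra.

Import Order.TTheory GRing.Theory Num.Theory.
Import numFieldNormedType.Exports.
Import ComplexField.Normc.

Local Open Scope classical_set_scope.
Local Open Scope ring_scope.

Set Implicit Arguments.
Unset Strict Implicit.
Unset Printing Implicit Defensive.

(** * Complex moduli and differentiability *)

Section complex_modulus.
Variable R : realType.
Implicit Types (z w : Cplx R) (f : Cplx R -> Cplx R).

Lemma normcD_le z w : normc (z + w) <= normc z + normc w :> R.
Proof. exact: le_normcD. Qed.

Lemma normC_normc z : `|z| = ((normc z)%:C)%C :> Cplx R.
Proof. by []. Qed.

Lemma normc_ge0 z : 0 <= normc z :> R.
Proof. by case: z => a b; exact: sqrtr_ge0. Qed.

Lemma normc_gt0 z : z != 0 -> 0 < normc z :> R.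
Proof.
move=> z0; rewrite lt_neqAle normc_ge0 andbT eq_sym.
by apply: contra z0 => /eqP /eq0_normc ->.
Qed.

Lemma normC_lt z (e : R) : (`|z| < (e%:C)%C :> Cplx R) = (normc z < e).
Proof. by rewrite normC_normc ltcE /= eqxx. Qed.

(** The norm topology of [Cplx R] has radii in [Cplx R] itself. In its order a positive element has
    zero imaginary part, so every such epsilon comes from a real one. *)
Lemma gt0_complexP (e : Cplx R) : 0 < e -> exists2 a : R, 0 < a & e = (a%:C)%C.
Proof. by case: e => a b; rewrite ltcE /= => /andP[/eqP -> a0]; exists a. Qed.

Lemma Re_le_normc w : `|complex.Re w| <= normc w.
Proof.
by case: w => a b /=; rewrite -sqrtr_sqr ler_wsqrtr// lerDl sqr_ge0.
Qed.

Lemma Im_le_normc w : `|complex.Im w| <= normc w.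
Proof.
by case: w => a b /=; rewrite -sqrtr_sqr ler_wsqrtr// lerDr sqr_ge0.
Qed.

Lemma normc_le_ReIm w : normc w <= `|complex.Re w| + `|complex.Im w|.
Proof.
case: w => a b /=; rewrite -[leRHS]ger0_norm ?addr_ge0// -sqrtr_sqr ler_wsqrtr//.
by rewrite sqrrD !real_normK ?num_real// lerD2r lerDl mulrn_wge0// mulr_ge0.
Qed.

Lemma normc_nat (n : nat) : normc (n%:R : Cplx R) = n%:R.
Proof. by have := @normcMn R 1 n; rewrite normc1. Qed.

Lemma dist_normc z w : `|normc z - normc w| <= normc (z - w).
Proof.
have h (a b : Cplx R) : normc a - normc b <= normc (a - b).
  by rewrite lerBlDr -{1}[a](subrK b); exact: normcD_le.
by have := h z w; have := h w z; rewrite -(normcN (w - z)) opprB ler_norml; lra.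
Qed.

Lemma nbhs_normcP z (P : set (Cplx R)) :
  nbhs z P <-> exists2 d : R, 0 < d & forall w, normc (w - z) < d -> P w.
Proof.
split => [/nbhs_ballP[_ /= /gt0_complexP[d d0 ->] dP] | [d d0 dP]].
  by exists d => // w wz; apply: dP; rewrite -ball_normE /= distrC normC_lt.
apply/nbhs_ballP; exists (d%:C)%C => /=; first by rewrite ltcE /= eqxx.
by move=> w; rewrite -ball_normE /= distrC normC_lt; exact: dP.
Qed.

(** First-order expansion with derivative [L]. Multiplying out the difference quotient makes the
    bound meaningful at [w = z] too. *)
Lemma derivable_normcP f z : derivable f z 1 <->
  exists L : Cplx R, forall e : R, 0 < e -> exists2 d : R, 0 < d &
    forall w, normc (w - z) < d -> normc (f w - f z - L * (w - z)) <= e * normc (w - z).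
Proof.
have quotE (L h : Cplx R) : h != 0 ->
    normc (L - h^-1 *: (f (h *: 1 + z) - f z)) * normc h =
    normc (f (h + z) - f z - L * h).
  move=> h0; rewrite -normcM -[RHS]normcN; congr normc.
  by rewrite scaler1 mulrBl opprB; congr (_ - _); rewrite -mulrAC mulVf// mul1r.
split=> [/cvg_ex[L /cvgrPdist_lt fL]|[L HL]].
  exists L => e e0.
  have e0' : 0 < (e%:C)%C :> Cplx R by rewrite ltcE /= eqxx.
  have /nbhs_normcP[d d0 dP] := fL _ e0'.
  exists d => // w wz; have [->|wz0] := eqVneq w z.
    by rewrite !subrr mulr0 subrr normc0 mulr0.
  have h0 : w - z != 0 by rewrite subr_eq0.
  have := dP (w - z); rewrite subr0 => /(_ wz h0); rewrite normC_lt => lt_e.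
  by rewrite -{1}[w](subrK z) -quotE// ler_wpM2r// ?normc_ge0// ltW.
apply/cvg_ex; exists L; apply/cvgrPdist_le => _ /gt0_complexP[e e0 ->].
have [d d0 dP] := HL e e0.
apply/nbhs_normcP; exists d => // h; rewrite subr0 => hd h0 /=.
rewrite normC_normc lecE /= eqxx /=.
rewrite -(ler_pM2r (normc_gt0 h0)) quotE//.
by have := dP (h + z); rewrite addrK; exact.
Qed.

Lemma derivable_continuous_normc f z : derivable f z 1 ->
  forall e : R, 0 < e -> exists2 d : R, 0 < d &
    forall w, normc (w - z) < d -> normc (f w - f z) < e.
Proof.
move=> /derivable_normcP[L /(_ 1 ltr01)[d d0 dP]] e e0.
pose M := 1 + normc L.
have M0 : 0 < M by rewrite ltr_pwDl// normc_ge0.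
exists (Num.min d (e / M)); first by rewrite lt_min d0 divr_gt0.
move=> w; rewrite lt_min => /andP[wd wM].
have -> : f w - f z = (f w - f z - L * (w - z)) + L * (w - z) by rewrite subrK.
apply: le_lt_trans (normcD_le _ _) _; rewrite normcM.
have := dP _ wd; move: wM; rewrite ltr_pdivlMr// /M; lra.
Qed.

Lemma compact_closed_Cplx (K : set (Cplx R)) : compact K -> closed K.
Proof. by apply: compact_closed; exact: norm_hausdorff. Qed.

End complex_modulus.

(** * Integrals over segments and circulation around squares *)

Section integral.
Variable R : realType.
Implicit Types (f g : R -> R) (a b c : R).

Definition itg a b f := (\int[@lebesgue_measure R]_(t in `[a, b]) f t)%R.

Lemma segment_integrable a b f : {within `[a, b], continuous f} ->
  (@lebesgue_measure R).-integrable `[a, b] (EFin \o f).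
Proof. by move=> cf; apply: continuous_compact_integrable => //; exact: segment_compact. Qed.

Lemma itg_cst a b c : a <= b -> itg a b (fun=> c) = c * (b - a).
Proof.
move=> ab; rewrite /itg Rintegral_cst//; congr (_ * _).
rewrite [X in fine X]lebesgue_measure_itv /= lte_fin.
by case: ltgtP ab => // -> _; rewrite subrr.
Qed.

Lemma itg_split a b c f : a <= b -> b <= c -> {within `[a, c], continuous f} ->
  itg a c f = itg a b f + itg b c f.
Proof.
move=> ab bc cf; have intf := segment_integrable cf.
rewrite /itg -[X in _ + X]Rintegral_itv_obnd_cbnd; last first.
  by apply: integrableS intf => //; apply: subset_itvr; rewrite bnd_simp.
by rewrite -(@Rintegral_itvB _ f (BLeft a) (BRight c) b) ?bnd_simp// addrC subrK.
Qed.

Lemma within_continuousB a b f g : {within `[a, b], continuous f} ->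
  {within `[a, b], continuous g} -> {within `[a, b], continuous (fun t => f t - g t)}.
Proof. by move=> cf cg x; apply: cvgB; [exact: cf|exact: cg]. Qed.

Lemma itgB a b f g : {within `[a, b], continuous f} ->
  {within `[a, b], continuous g} ->
  itg a b (fun t => f t - g t) = itg a b f - itg a b g.
Proof. by move=> cf cg; rewrite /itg RintegralB//; exact: segment_integrable. Qed.

Lemma le_itg a b f g : {within `[a, b], continuous f} ->
  {within `[a, b], continuous g} -> (forall t, a <= t <= b -> f t <= g t) ->
  itg a b f <= itg a b g.
Proof.
by move=> cf cg fg; apply: le_Rintegral => //; exact: segment_integrable.
Qed.

Lemma itg_ge a b c f : a <= b -> {within `[a, b], continuous f} ->
  (forall t, a <= t <= b -> c <= f t) -> c * (b - a) <= itg a b f.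
Proof.
move=> ab cf cle; rewrite -itg_cst//; apply: le_itg => // x; exact: cvg_cst.
Qed.

Lemma itg_le a b c f : a <= b -> {within `[a, b], continuous f} ->
  (forall t, a <= t <= b -> f t <= c) -> itg a b f <= c * (b - a).
Proof.
move=> ab cf cle; rewrite -itg_cst//; apply: le_itg => // x; exact: cvg_cst.
Qed.

(** Meant for opposite sides of a square: their integrands are compared pointwise before
    integrating, since only the difference is nearly constant. *)
Lemma itgB_near a b c e f g : a <= b -> {within `[a, b], continuous f} ->
  {within `[a, b], continuous g} ->
  (forall t, a <= t <= b -> `|f t - g t - c| <= e) ->
  `|itg a b f - itg a b g - c * (b - a) : R| <= e * (b - a).
Proof.
move=> ab cf cg fgc; rewrite -itgB//.
have cfg := within_continuousB cf cg.
rewrite ler_norml; apply/andP; split.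
  rewrite lerBrDr addrC -mulNr -mulrDl; apply: itg_ge => // t /fgc.
  by rewrite ler_norml => /andP[]; lra.
rewrite lerBlDr -mulrDl; apply: itg_le => // t /fgc.
by rewrite ler_norml => /andP[]; lra.
Qed.

End integral.

Section goursat.
Variable R : realType.
Implicit Types (F : Cplx R -> Cplx R) (z w : Cplx R) (x y s : R).

Definition square x y s : set (Cplx R) :=
  [set w | x <= complex.Re w <= x + s /\ y <= complex.Im w <= y + s].

Definition pt x y : Cplx R := (x +i* y)%C.

(** This is the imaginary part of the counterclockwise integral of $F(w)\,dw$: vertical sides have
    $dw = i\,dt$, and $\mathrm{Im}(iF) = \mathrm{Re}\,F$. The imaginary part is the one that detects
    $1/(w-z)$, whose integral is $2\pi i$. *)
Definition circulation F x y s : R :=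
  (itg x (x + s) (fun t => complex.Im (F (pt t y)))
   - itg x (x + s) (fun t => complex.Im (F (pt t (y + s)))))
  + (itg y (y + s) (fun t => complex.Re (F (pt (x + s) t)))
   - itg y (y + s) (fun t => complex.Re (F (pt x t)))).

(** Here [g] stands for the real or the imaginary part, and [l] for the parametrisation of a
    side. *)
Lemma line_continuous F (g : Cplx R -> R) (l : R -> Cplx R) a b :
  (forall w, `|g w| <= normc w) -> (forall w w', g (w - w') = g w - g w') ->
  (forall t u, normc (l t - l u) <= `|t - u|) ->
  (forall t, a <= t <= b -> derivable F (l t) 1) ->
  {within `[a, b], continuous (fun t => g (F (l t)))}.
Proof.
move=> gn gB ll dF; apply: continuous_in_subspaceT => t.
rewrite inE /= in_itv /= => /dF/derivable_continuous_normc cF.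
apply/cvgrPdist_lt => e /cF[d d0 dP]; near=> u.
rewrite -gB; apply: le_lt_trans (gn _) _; rewrite -normcN opprB; apply: dP.
apply: le_lt_trans (ll _ _) _; rewrite distrC; near: u.
exact: cvgr_dist_lt.
Unshelve. all: by end_near. Qed.

Lemma normc_ptB x y x' y' : normc (pt x y - pt x' y') <= `|x - x'| + `|y - y'|.
Proof. exact: normc_le_ReIm. Qed.

Section sides.
Variables (F : Cplx R -> Cplx R) (x y s : R).
Hypothesis dF : forall w, square x y s w -> derivable F w 1.

Lemma horizontal_continuous a b h : x <= a -> b <= x + s -> y <= h <= y + s ->
  {within `[a, b], continuous (fun t => complex.Im (F (pt t h)))}.
Proof.
move=> xa bx hy; apply: (@line_continuous F (@complex.Im R) (pt^~ h)).
- exact: Im_le_normc.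
- by case=> ? ? [].
- by move=> t u; rewrite (le_trans (normc_ptB _ _ _ _))// subrr normr0 addr0.
- by move=> t /andP[at_ tb]; apply: dF; split=> //=; rewrite (le_trans xa)// (le_trans tb).
Qed.

Lemma vertical_continuous a b h : y <= a -> b <= y + s -> x <= h <= x + s ->
  {within `[a, b], continuous (fun t => complex.Re (F (pt h t)))}.
Proof.
move=> xa bx hy; apply: (@line_continuous F (@complex.Re R) (pt h)).
- exact: Re_le_normc.
- by case=> ? ? [].
- by move=> t u; rewrite (le_trans (normc_ptB _ _ _ _))// subrr normr0 add0r.
- by move=> t /andP[at_ tb]; apply: dF; split=> //=; rewrite (le_trans xa)// (le_trans tb).
Qed.

End sides.

(** Each outer side splits at its midpoint; the inner sides are traversed once in each direction and
    cancel. *)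
Lemma circulation_quarter F x y h : 0 <= h ->
  (forall w, square x y (h + h) w -> derivable F w 1) ->
  circulation F x y (h + h) = circulation F x y h + circulation F (x + h) y h
    + circulation F x (y + h) h + circulation F (x + h) (y + h) h.
Proof.
move=> h0 dF.
have hor k : y <= k <= y + (h + h) ->
    itg x (x + (h + h)) (fun t => complex.Im (F (pt t k))) =
    itg x (x + h) (fun t => complex.Im (F (pt t k))) +
    itg (x + h) (x + h + h) (fun t => complex.Im (F (pt t k))).
  move=> kP; rewrite -addrA; apply: itg_split; [lra|lra|].
  exact: (horizontal_continuous dF).
have ver k : x <= k <= x + (h + h) ->
    itg y (y + (h + h)) (fun t => complex.Re (F (pt k t))) =
    itg y (y + h) (fun t => complex.Re (F (pt k t))) +
    itg (y + h) (y + h + h) (fun t => complex.Re (F (pt k t))).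
  move=> kP; rewrite -addrA; apply: itg_split; [lra|lra|].
  exact: (vertical_continuous dF).
rewrite /circulation !hor ?ver; [|lra..].
rewrite !(addrA _ h h); ring.
Qed.

(** Near [z] the function is affine up to a small error. The affine part contributes
    $-s^2\,\mathrm{Re}\,L$ from the horizontal sides and $+s^2\,\mathrm{Re}\,L$ from the vertical
    ones. Points of the square lie within $2s$ of [z], so the error is at most $es/4$ at a point,
    $es/2$ for a difference, and $es^2/2$ for each pair of sides. *)
Lemma circulation_local F z (e : R) : derivable F z 1 -> 0 < e ->
  exists2 d : R, 0 < d & forall x y s, 0 < s -> s < d -> square x y s z ->
    (forall w, square x y s w -> derivable F w 1) ->
    `|circulation F x y s| <= e * s ^+ 2.
Proof.
move=> /derivable_normcP[L HL] e0.
have [|d d0 dP] := HL (e / 8); first by rewrite divr_gt0.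
exists (d / 2); first by rewrite divr_gt0.
move=> x y s s0 sd [/= zx zy] dF.
have close a b : x <= a <= x + s -> y <= b <= y + s ->
    normc (F (pt a b) - F z - L * (pt a b - z)) <= e / 4 * s.
  move=> ax bx.
  have lt2 : normc (pt a b - z) <= s + s.
    apply: le_trans (normc_le_ReIm _) _; case: (z) zx zy => z1 z2 /= zx zy.
    by rewrite lerD// ler_norml; lra.
  apply: le_trans (dP _ _) _; first lra.
  by apply: le_trans (ler_wpM2l _ lt2) _; lra.
have diff a b a' b' : x <= a <= x + s -> y <= b <= y + s ->
    x <= a' <= x + s -> y <= b' <= y + s ->
    normc (F (pt a b) - F (pt a' b') - L * (pt a b - pt a' b')) <= e / 2 * s.
  move=> Ha Hb Ha' Hb'.
  have -> : F (pt a b) - F (pt a' b') - L * (pt a b - pt a' b') =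
     (F (pt a b) - F z - L * (pt a b - z)) +
     - (F (pt a' b') - F z - L * (pt a' b' - z)) by ring.
  apply: le_trans (normcD_le _ _) _; rewrite normcN.
  by have := close _ _ Ha Hb; have := close _ _ Ha' Hb'; lra.
have hor : `|itg x (x + s) (fun t => complex.Im (F (pt t y))) -
    itg x (x + s) (fun t => complex.Im (F (pt t (y + s)))) -
    - (complex.Re L * s) * (x + s - x)| <= e / 2 * s * (x + s - x).
  apply: itgB_near; first lra.
  - by apply: (horizontal_continuous dF); lra.
  - by apply: (horizontal_continuous dF); lra.
  move=> t tP; apply: le_trans (diff t y t (y + s) _ _ _ _); [|lra..].
  apply: le_trans (Im_le_normc _); rewrite le_eqVlt; apply/orP; left; apply/eqP.
  congr `| _ |; rewrite /pt; case: (F _) => ? ?; case: (F _) => ? ?; case: (L) => ? ? /=.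
  ring.
have ver : `|itg y (y + s) (fun t => complex.Re (F (pt (x + s) t))) -
    itg y (y + s) (fun t => complex.Re (F (pt x t))) -
    complex.Re L * s * (y + s - y)| <= e / 2 * s * (y + s - y).
  apply: itgB_near; first lra.
  - by apply: (vertical_continuous dF); lra.
  - by apply: (vertical_continuous dF); lra.
  move=> t tP; apply: le_trans (diff (x + s) t x t _ _ _ _); [|lra..].
  apply: le_trans (Re_le_normc _); rewrite le_eqVlt; apply/orP; left; apply/eqP.
  congr `| _ |; rewrite /pt; case: (F _) => ? ?; case: (F _) => ? ?; case: (L) => ? ? /=.
  ring.
rewrite /circulation; move: hor ver; rewrite !ler_norml; move: (itg _ _ _) => I1.
move: (itg _ _ _) => I2; move: (itg _ _ _) => I3; move: (itg _ _ _) => I4.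
rewrite (addrC x s) addrK (addrC y s) addrK; nra.
Qed.

End goursat.

(** * Goursat's theorem *)

Section goursat_theorem.
Variable R : realType.
Implicit Types (F : Cplx R -> Cplx R) (z w : Cplx R) (x y s : R).

(** Four quarters obeying the bound $eh^2$ would add up to at most $e(2h)^2$. *)
Lemma exists_bad_quarter F x y h (e : R) : 0 <= h ->
  (forall w, square x y (h + h) w -> derivable F w 1) ->
  e * (h + h) ^+ 2 < `|circulation F x y (h + h)| ->
  exists q : R * R, [/\ x <= q.1 <= x + h, y <= q.2 <= y + h &
    e * h ^+ 2 < `|circulation F q.1 q.2 h|].
Proof.
move=> h0 dF; rewrite circulation_quarter// => bad.
apply: contrapT => nq.
have ok q : x <= q.1 <= x + h -> y <= q.2 <= y + h -> `|circulation F q.1 q.2 h| <= e * h ^+ 2.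
  by move=> qx qy; rewrite leNgt; apply/negP => bq; apply: nq; exists q.
have := ok (x, y); have := ok (x + h, y); have := ok (x, y + h); have := ok (x + h, y + h).
rewrite /= !lexx !lerDl h0 /= => /(_ isT isT) o1 /(_ isT isT) o2 /(_ isT isT) o3 /(_ isT isT) o4.
move: bad; rewrite ltNge => /negP; apply.
rewrite (_ : e * (h + h) ^+ 2 = e * h ^+ 2 + e * h ^+ 2 + e * h ^+ 2 + e * h ^+ 2); last by ring.
by do 3 (apply: le_trans (ler_normD _ _) _; apply: lerD => //).
Qed.

(** Every left endpoint is below every right endpoint, so the supremum of the left endpoints
    works. *)
Lemma nested_intervals (x s : nat -> R) :
  (forall n, x n <= x n.+1 /\ x n.+1 + s n.+1 <= x n + s n) -> (forall n, 0 <= s n) ->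
  exists c, forall n, x n <= c <= x n + s n.
Proof.
move=> nest s0.
have xle m n : (m <= n)%N -> x m <= x n.
  elim: n => [|n IH]; first by rewrite leqn0 => /eqP ->.
  rewrite leq_eqVlt => /predU1P[->//|/IH]; move/le_trans; apply.
  by case: (nest n).
have sle m n : (m <= n)%N -> x n + s n <= x m + s m.
  elim: n => [|n IH]; first by rewrite leqn0 => /eqP ->.
  rewrite leq_eqVlt => /predU1P[->//|/IH]; apply: le_trans.
  by case: (nest n).
have xs m n : x m <= x n + s n.
  apply: le_trans (xle _ _ (leq_maxl m n)) _; apply: le_trans (sle _ _ (leq_maxr m n)).
  by rewrite lerDl.
exists (sup (range x)) => n; apply/andP; split.
  apply: ub_le_sup; last by exists n.
  by exists (x 0 + s 0) => _ [m _ <-].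
apply: ge_sup; first by exists (x 0), 0.
by move=> _ [m _ <-].
Qed.

(** Repeated quartering keeps the circulation above [e] times the area. At the common point of the
    nested squares this contradicts [circulation_local]. *)
Theorem goursat F x y s : 0 < s -> (forall w, square x y s w -> derivable F w 1) ->
  circulation F x y s = 0.
Proof.
move=> s0 dF; apply/eqP/negP => /negP J0.
(* The factor 2 makes the inequality strict for the initial square. *)
pose e := `|circulation F x y s| / (s ^+ 2 * 2).
have s2 : 0 < s ^+ 2 by rewrite exprn_gt0.
have e0 : 0 < e by rewrite divr_gt0 ?normr_gt0// mulr_gt0.
have bad0 : e * s ^+ 2 < `|circulation F x y s|.
  rewrite /e (_ : _ * s ^+ 2 = `|circulation F x y s| / 2).
    by rewrite ltr_pdivrMr// ltr_pMr ?normr_gt0// ltr1n.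
  by field; rewrite gt_eqF.
pose sz n := s / 2 ^+ n.
have sz0 n : 0 < sz n by rewrite divr_gt0// exprn_gt0.
have szS n : sz n = sz n.+1 + sz n.+1.
  by rewrite /sz exprS; field; rewrite gt_eqF// exprn_gt0.
pose inside n (q : R * R) := forall w, square q.1 q.2 (sz n) w -> square x y s w.
pose bad n (q : R * R) := inside n q /\ e * sz n ^+ 2 < `|circulation F q.1 q.2 (sz n)|.
have next (nq : nat * (R * R)) : exists q' : R * R, bad nq.1 nq.2 ->
    [/\ nq.2.1 <= q'.1 <= nq.2.1 + sz nq.1.+1, nq.2.2 <= q'.2 <= nq.2.2 + sz nq.1.+1
      & bad nq.1.+1 q'].
  case: nq => n [a b] /=.
  (* The value [(0, 0)] is a dummy that makes the successor total, as [choice] requires. *)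
  have [[ins badab]|] := pselect (bad n (a, b)); last by exists (0, 0).
  move: badab; rewrite /= szS => badab.
  have [||q' [qa qb bq]] := exists_bad_quarter _ _ badab; first exact: ltW.
    by move=> w; rewrite -szS => /ins/dF.
  exists q' => _; split=> //; split=> // w [/= wa wb]; apply: ins.
  by split=> /=; rewrite szS; lra.
have [nx nxP] := choice next.
pose u := fix u n := if n is m.+1 then nx (m, u m) else (x, y).
have ubad n : bad n (u n).
  elim: n => [|n IH]; last by case: (nxP (n, u n)).
  have sz00 : sz 0 = s by rewrite /sz expr0 divr1.
  by split; rewrite /inside /= sz00.
have uS n := nxP (n, u n) (ubad n).
have [|n|cx cxP] := @nested_intervals (fun n => (u n).1) sz; last 2 first.
- exact: ltW.
- have [|n|cy cyP] := @nested_intervals (fun n => (u n).2) sz; last 2 first.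
  + exact: ltW.
  + have cin n : square (u n).1 (u n).2 (sz n) (pt cx cy) by split; [exact: cxP|exact: cyP].
    have dc : derivable F (pt cx cy) 1 by apply/dF/(proj1 (ubad 0)).
    have [d d0 dP] := circulation_local dc e0.
    have [n nP] : exists n, sz n < d.
      exists (Num.bound (s / d)); rewrite /sz ltr_pdivrMr ?exprn_gt0//.
      rewrite mulrC -ltr_pdivrMr//.
      apply: lt_trans (archi_boundP _) _; first by rewrite ltW// divr_gt0.
      by rewrite -natrX ltr_nat ltn_expl.
    have [ins] := ubad n; rewrite ltNge => /negP; apply.
    by apply: (dP _ _ _ (sz0 n) nP (cin n)) => w /ins; exact: dF.
  + by move=> n; have [_ /= bn _] := uS n; rewrite (szS n); lra.
by move=> n; have [/= an _ _] := uS n; rewrite (szS n); lra.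
Qed.

End goursat_theorem.

(** * Functions close to 1 / (w - z) on the boundary of a square *)

Section interior.
Variable R : realType.

(** With $w - z = a + ib$ and $F = p + iq$, the hypotheses say that $(w-z)F$ is close to 1. Then
    $p(a^2+b^2) = a\,\mathrm{Re}((w-z)F) + b\,\mathrm{Im}((w-z)F) \ge 3r/4 - r/4$, while $a^2+b^2
    \le 2r^2$. *)
Lemma near_inverse_ge (a b p q r : R) : 0 < r -> a = r -> `|b| <= r ->
  `|a * p - b * q - 1| <= 1 / 4 -> `|a * q + b * p| <= 1 / 4 -> 1 / (4 * r) <= p.
Proof.
move=> r0 -> bP; rewrite ler_norml => /andP[h1 _] h2.
have h3 : `|b * (r * q + b * p)| <= r * (1 / 4) by rewrite normrM ler_pM.
have b2 : b ^+ 2 <= r ^+ 2 by rewrite -(real_normK (num_real b)) lerXn2r ?nnegrE ?(ltW r0).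
have p_ge : r / 2 <= p * (r ^+ 2 + b ^+ 2).
  rewrite (_ : p * _ = r * (r * p - b * q) + b * (r * q + b * p)); last by ring.
  move: h3; rewrite ler_norml => /andP[h3 _].
  have : r * (3 / 4) <= r * (r * p - b * q) by rewrite ler_pM2l//; lra.
  lra.
have p0 : 0 < p.
  rewrite -(pmulr_lgt0 (x := r ^+ 2 + b ^+ 2)); last by rewrite ltr_pwDl ?exprn_gt0// sqr_ge0.
  by apply: lt_le_trans p_ge; rewrite divr_gt0.
rewrite ler_pdivrMr ?mulr_gt0//.
have : p * (r ^+ 2 + b ^+ 2) <= p * (2 * r ^+ 2) by rewrite ler_pM2l//; lra.
move/(le_trans p_ge) => h; rewrite -(ler_pM2r r0); lra.
Qed.

(* The integrand of the circulation inherits the sign of that of [1 / (w - z)] on each side. *)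
Lemma not_near_inverse (F : Cplx R -> Cplx R) (z : Cplx R) (r : R) : 0 < r ->
  (forall w, square (complex.Re z - r) (complex.Im z - r) (r + r) w -> derivable F w 1) ->
  ~ (forall w, square (complex.Re z - r) (complex.Im z - r) (r + r) w ->
     r <= normc (w - z) -> normc ((w - z) * F w - 1) <= 1 / 4).
Proof.
move=> r0 dF near1.
set x := complex.Re z - r in dF near1; set y := complex.Im z - r in dF near1.
have rr0 : 0 < r + r by rewrite addr_gt0.
have F1 u v : x <= u <= x + (r + r) -> y <= v <= y + (r + r) ->
    (r <= `|u - complex.Re z|) || (r <= `|v - complex.Im z|) ->
    let a := u - complex.Re z in let b := v - complex.Im z in
    let p := complex.Re (F (pt u v)) in let q := complex.Im (F (pt u v)) in
    `|a * p - b * q - 1| <= 1 / 4 /\ `|a * q + b * p| <= 1 / 4.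
  move=> ux vy ruv; have /= := near1 (pt u v) (conj ux vy).
  have -> : r <= normc (pt u v - z).
    case/orP: ruv => /le_trans; apply.
      by apply: le_trans (Re_le_normc _); case: (z).
    by apply: le_trans (Im_le_normc _); case: (z).
  move=> /(_ isT) le4; split; [apply: le_trans le4; apply: le_trans (Re_le_normc _)|
      apply: le_trans le4; apply: le_trans (Im_le_normc _)];
    by rewrite /pt; case: (F _) => ? ?; case: (z) => ? ? /=; rewrite ?subr0.
have c0 : 0 < 1 / (4 * r) by rewrite divr_gt0// mulr_gt0.
have := goursat rr0 dF; rewrite /circulation.
have bottom : 1 / (4 * r) * (x + (r + r) - x) <=
    itg x (x + (r + r)) (fun t => complex.Im (F (pt t y))).
  apply: itg_ge; first lra.
    by apply: (horizontal_continuous dF); lra.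
  move=> t tP; have [||| /= e1 e2] := F1 t y => //; first lra.
    by apply/orP; right; rewrite ler_normr; apply/orP; right; rewrite /y; lra.
  (* Rotation reduces each side to the right-hand one: here $w-z$ is multiplied by $i$ and $F$ by
     $-i$, which preserves the product. The top uses $-i$ and $i$, the left side $-1$ and $-1$. *)
  apply: (@near_inverse_ge (- (y - complex.Im z)) (t - complex.Re z) _
    (- complex.Re (F (pt t y)))) => //.
  - by rewrite /y; ring.
  - by rewrite ler_norml; move: tP; rewrite /x; lra.
  - by apply: le_trans e1; rewrite le_eqVlt; apply/orP; left; apply/eqP; congr `|_|; ring.
  - by apply: le_trans e2; rewrite le_eqVlt; apply/orP; left; apply/eqP; congr `|_|; ring.
have top : itg x (x + (r + r)) (fun t => complex.Im (F (pt t (y + (r + r))))) <=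
    - (1 / (4 * r)) * (x + (r + r) - x).
  apply: itg_le; first lra.
    by apply: (horizontal_continuous dF); lra.
  move=> t tP; have [||| /= e1 e2] := F1 t (y + (r + r)) => //; first lra.
    by apply/orP; right; rewrite ler_normr; apply/orP; left; rewrite /y; lra.
  rewrite lerNr.
  apply: (@near_inverse_ge (y + (r + r) - complex.Im z) (- (t - complex.Re z)) _
    (complex.Re (F (pt t (y + (r + r)))))) => //.
  - by rewrite /y; ring.
  - by rewrite ler_norml; move: tP; rewrite /x; lra.
  - by apply: le_trans e1; rewrite le_eqVlt; apply/orP; left; apply/eqP; congr `|_|; ring.
  - by apply: le_trans e2; rewrite le_eqVlt; apply/orP; left; apply/eqP; congr `|_|; ring.
have right_ : 1 / (4 * r) * (y + (r + r) - y) <=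
    itg y (y + (r + r)) (fun t => complex.Re (F (pt (x + (r + r)) t))).
  apply: itg_ge; first lra.
    by apply: (vertical_continuous dF); lra.
  move=> t tP; have [||| /= e1 e2] := F1 (x + (r + r)) t => //; first lra.
    by apply/orP; left; rewrite ler_normr; apply/orP; left; rewrite /x; lra.
  apply: (@near_inverse_ge (x + (r + r) - complex.Re z) (t - complex.Im z) _
    (complex.Im (F (pt (x + (r + r)) t)))) => //.
  - by rewrite /x; ring.
  - by rewrite ler_norml; move: tP; rewrite /y; lra.
have left_ : itg y (y + (r + r)) (fun t => complex.Re (F (pt x t))) <=
    - (1 / (4 * r)) * (y + (r + r) - y).
  apply: itg_le; first lra.
    by apply: (vertical_continuous dF); lra.
  move=> t tP; have [||| /= e1 e2] := F1 x t => //; first lra.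
    by apply/orP; left; rewrite ler_normr; apply/orP; right; rewrite /x; lra.
  rewrite lerNr.
  apply: (@near_inverse_ge (- (x - complex.Re z)) (- (t - complex.Im z)) _
    (- complex.Im (F (pt x t)))) => //.
  - by rewrite /x; ring.
  - by rewrite ler_norml; move: tP; rewrite /y; lra.
  - by apply: le_trans e1; rewrite le_eqVlt; apply/orP; left; apply/eqP; congr `|_|; ring.
  - by apply: le_trans e2; rewrite le_eqVlt; apply/orP; left; apply/eqP; congr `|_|; ring.
(* Each side, with its sign, contributes at least this positive amount, so the circulation cannot
   vanish. *)
have : 0 < 1 / (4 * r) * (r + r) by rewrite mulr_gt0.
move: bottom top right_ left_; rewrite (addrC x) addrK (addrC y) addrK !mulNr.
move: (itg _ _ _) => I1; move: (itg _ _ _) => I2; move: (itg _ _ _) => I3; move: (itg _ _ _) => I4.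
move: (1 / _ * _) => k; rewrite ?addrA; lra.
Qed.

End interior.

(** * Interior points *)

Section sup_norm.
Variables (R : realType) (K : set (Cplx R)).
Implicit Types (z w : Cplx R) (f g : Cplx R -> Cplx R).

Lemma within_normcP f : {within K, continuous f} <->
  forall z, K z -> forall e : R, 0 < e -> exists2 d : R, 0 < d &
    forall w, K w -> normc (w - z) < d -> normc (f w - f z) < e.
Proof.
split=> [/subspace_continuousP cf z Kz e e0|cf].
  have /cvgrPdist_lt/(_ (e%:C)%C) := cf z Kz.
  rewrite {1}ltcE /= eqxx => /(_ e0) /nbhs_normcP[d d0 dP].
  by exists d => // w Kw wz; have := dP _ wz Kw; rewrite distrC normC_lt.
apply/subspace_continuousP => z Kz; apply/cvgrPdist_lt => _ /gt0_complexP[e e0 ->].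
have [d d0 dP] := cf z Kz e e0.
by apply/nbhs_normcP; exists d => // w wz Kw; rewrite distrC normC_lt; exact: dP.
Qed.

Lemma within_normc_continuous f : {within K, continuous f} ->
  {within K, continuous (fun w => normc (f w))}.
Proof.
move=> cf x; apply/cvgrPdist_lt => e e0.
have e0' : 0 < (e%:C)%C :> Cplx R by rewrite ltcE /= eqxx.
have /cvgrPdist_lt/(_ _ e0') := cf x.
apply: filterS => w; rewrite normC_lt; apply: le_lt_trans.
exact: dist_normc.
Qed.

Lemma normc_le_sup_norm f w : compact K -> {within K, continuous f} -> K w ->
  normc (f w) <= sup_norm K f.
Proof.
move=> cK cf Kw; apply: ub_le_sup; last by exists w.
have [] // : has_sup [set normc (f z) | z in K].
apply: compact_has_sup; first by exists (normc (f w)), w.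
by apply: continuous_compact => //; exact: within_normc_continuous.
Qed.

Lemma sup_norm_le f (c : R) : K !=set0 -> (forall w, K w -> normc (f w) <= c) ->
  sup_norm K f <= c.
Proof.
move=> [w Kw] fc; apply: ge_sup; first by exists (normc (f w)), w.
by move=> _ [v Kv <-]; exact: fc.
Qed.

(** Differentiability in the plane at each point of [K] gives continuity on [K]; near an interior
    point the zero extension agrees with [f]. *)
Lemma patch_uniform_algebra f : (forall w, K w -> derivable f w 1) ->
  uniform_algebra K (patch (fun=> 0) K f).
Proof.
move=> df; split.
- apply/within_normcP => z Kz e /(derivable_continuous_normc (df z Kz))[d d0 dP].
  exists d => // w Kw /dP.
  by rewrite !patchT ?inE.
- move=> z Kz; apply: near_eq_derivable (df z (interior_subset Kz)).
  by apply: filterS Kz => w Kw; rewrite patchT ?inE.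
- by move=> z Kz; rewrite patchN // notin_setE.
Qed.

End sup_norm.

(** * Nonexistence at interior points *)

Section interior_point.
Variables (R : realType) (K : set (Cplx R)).

(** The square makes the value 0 of the formula at [z] agree with the limit there; f / (w - z) would
    tend to [L] instead. Writing $f = Lh + \rho$, the remainder is $f^2/h - L^2h = (2L +
    \rho/h)\rho$. *)
Lemma derivable_sqr_div (f : Cplx R -> Cplx R) (z : Cplx R) :
  derivable f z 1 -> f z = 0 -> derivable (fun w => f w ^+ 2 / (w - z)) z 1.
Proof.
move=> /derivable_normcP[L HL] fz; apply/derivable_normcP; exists (L ^+ 2) => e e0.
pose M := 2 * normc L + 1.
have M0 : 0 < M by rewrite ltr_wpDl// mulr_ge0// normc_ge0.
pose e' := Num.min 1 (e / M).
have e'0 : 0 < e' by rewrite lt_min ltr01 divr_gt0.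
have e'1 : e' <= 1 by rewrite ge_min lexx.
have e'M : e' * M <= e by rewrite -ler_pdivlMr// ge_min lexx orbT.
have [d d0 dP] := HL e' e'0; exists d => // w wd.
rewrite fz expr0n mul0r subr0.
have [->|wz] := eqVneq w z; first by rewrite fz subrr expr0n mul0r mulr0 subr0 normc0 mulr0.
have h0 : w - z != 0 by rewrite subr_eq0.
have := dP w wd; rewrite fz subr0; set h := w - z in h0 *; set rho := f w - L * h => rle.
have -> : f w ^+ 2 / h - L ^+ 2 * h = (2 * L + rho / h) * rho.
  by rewrite (_ : f w = L * h + rho); [field|rewrite /rho; ring].
rewrite normcM; apply: le_trans (_ : M * (e' * normc h) <= _); last first.
  by rewrite mulrA (mulrC M) ler_wpM2r// normc_ge0.
apply: ler_pM => //; rewrite ?normc_ge0//.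
apply: le_trans (normcD_le _ _) _; rewrite !normcM lerD//.
  by rewrite ler_wpM2r ?normc_ge0// -[2]/(1 + 1) (le_trans (normcD_le _ _))// normc1.
rewrite normcV ler_pdivrMr ?normc_gt0// mul1r.
by apply: le_trans rle _; rewrite ler_piMl// normc_ge0.
Qed.

Lemma interior_no_bai (z : Cplx R) : compact K -> K° z ->
  ~ has_bounded_approximate_identity (sup_norm K) (vanishing_ideal K z).
Proof.
move=> cK Kz [I [le [e [[_ le_refl _ _] eM _ ecvg]]]].
pose f := patch (fun=> 0) K (fun w => w - z).
have fM : vanishing_ideal K z f.
  split; last by rewrite /f patchT ?subrr ?inE//; exact: interior_subset.
  by apply: patch_uniform_algebra => w _; apply: derivableB.
have /nbhs_normcP[d d0 dP] : nbhs z K° by apply: open_nbhs_nbhs; split => //; exact: open_interior.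
(* The square of half-side [r] then lies in the disc of radius [d], since $2r < d$. *)
pose r := d / 3.
have r0 : 0 < r by rewrite divr_gt0.
(* Where $|w-z| \ge r$ this gives $|g-1| \le 1/10$, hence $|g^2-1| \le (1/10)(21/10) < 1/4$. *)
have [|i0 i0P] := ecvg f fM (r / 10); first by rewrite divr_gt0.
have {i0P ecvg} := i0P i0 (le_refl i0); have [[ce de _] ez] := eM i0.
set g := e i0 in ce de ez * => gsmall.
have inK w : square (complex.Re z - r) (complex.Im z - r) (r + r) w -> K° w.
  move=> [/= wx wy]; apply: dP; apply: le_lt_trans (normc_le_ReIm _) _.
  apply: le_lt_trans (_ : r + r < d); last by rewrite /r; lra.
  have [-> ->] : complex.Re (w - z) = complex.Re w - complex.Re z /\
    complex.Im (w - z) = complex.Im w - complex.Im z by case: (w) (z) => ? ? [].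
  by rewrite lerD// ler_norml; lra.
have cfg : {within K, continuous (f * g - f)}.
  have [[cf _ _] _] := fM.
  by move=> w; apply: cvgB; [apply: cvgM; [exact: cf|exact: ce]|exact: cf].
apply: (@not_near_inverse _ (fun w => g w ^+ 2 / (w - z)) z r r0).
  move=> w /inK Kw; have [->|wz] := eqVneq w z; first exact: derivable_sqr_div (de _ Kz) ez.
  apply: derivableM; first by apply (@derivableX _ _ g 2); exact: de.
  by apply: derivableV; [rewrite subr_eq0|exact: derivableB].
move=> w /inK/interior_subset Kw rwz.
have h0 : w - z != 0.
  by apply: contraTneq rwz => ->; rewrite normc0 -ltNge.
rewrite mulrC divfK// (_ : _ - 1 = (g w - 1) * (g w - 1 + 2)); last by ring.
have g1 : normc (g w - 1) <= 1 / 10.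
  have := normc_le_sup_norm cK cfg Kw => /le_lt_trans/(_ gsmall)/ltW.
  rewrite !fctE /f patchT ?inE// (_ : _ * _ - _ = (w - z) * (g w - 1)); last by ring.
  rewrite normcM => le1; rewrite -(ler_pM2l (normc_gt0 h0)).
  by apply: le_trans le1 _; lra.
have n2 : normc (2 : Cplx R) <= 2.
  by rewrite -[X in normc X]/(1 + 1) (le_trans (normcD_le _ _))// normc1.
rewrite normcM; apply: le_trans (_ : 1 / 10 * (1 / 10 + 2) <= _); last lra.
by rewrite ler_pM ?normc_ge0// (le_trans (normcD_le _ _))// lerD.
Qed.

End interior_point.

(** * Square roots of quotients *)

Section square_root.
Variable R : realType.
Implicit Types (w x : Cplx R).

Definition csqrt : Cplx R -> Cplx R := @sqrtc R.

Lemma csqrtK w : csqrt w ^+ 2 = w.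
Proof. exact: sqr_sqrtc. Qed.

Lemma Re_csqrt_ge0 w : 0 <= complex.Re (csqrt w).
Proof. by case: w => a b; exact: sqrtr_ge0. Qed.

Lemma Re_csqrt_gt0 w : 0 < complex.Re w -> 0 < complex.Re (csqrt w).
Proof.
by case: w => a b /= a0; rewrite sqrtr_gt0 divr_gt0// ltr_wpDl// sqrtr_ge0.
Qed.

(** All values of the root have nonnegative real part, so $|s+s_0| \ge c = \mathrm{Re}\,s_0 > 0$ and
    $|s-s_0| \le |w'-w|/c$. The remainder is exactly $-(s-s_0)^2/(2s_0)$, at most $|w'-w|^2/c^3$ in
    modulus; hence the radius $ec^3$. *)
Lemma derivable_csqrt w : 0 < complex.Re w -> derivable csqrt w 1.
Proof.
move=> w0; apply/derivable_normcP; set s0 := csqrt w.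
have c0 : 0 < complex.Re s0 by exact: Re_csqrt_gt0.
set c := complex.Re s0 in c0.
have cs (s : Cplx R) : 0 <= complex.Re s -> c <= normc (s + s0).
  move=> s1; apply: le_trans (Re_le_normc _); apply: le_trans (ler_norm _).
  by rewrite /c; case: (s) (s0) s1 => ? ? [? ?] /= *; rewrite lerDr.
have s0c : c <= normc s0 by apply: le_trans (Re_le_normc _); exact: ler_norm.
have s00 : s0 != 0 by apply: contraTneq s0c => ->; rewrite normc0 -ltNge.
exists (2 * s0)^-1 => e e0; exists (e * (c ^+ 3)); first by rewrite mulr_gt0// exprn_gt0.
move=> w' wd; set s := csqrt w'.
have sc := cs _ (Re_csqrt_ge0 w'); rewrite -/s in sc.
have wE : w' - w = (s - s0) * (s + s0) by rewrite -subr_sqr !csqrtK.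
have -> : s - s0 - (2 * s0)^-1 * (w' - w) = - ((s - s0) ^+ 2 / (2 * s0)).
  by rewrite wE; field.
have ss0 : normc (s - s0) * c <= normc (w' - w).
  by rewrite wE normcM ler_wpM2l// normc_ge0.
rewrite normcN normcM normcV expr2 normcM.
have c2 : c <= normc (2 * s0) by rewrite mulr_natl mulr2n; exact: cs (ltW c0).
rewrite ler_pdivrMr ?(lt_le_trans c0 c2)//.
have D0 := normc_ge0 (w' - w).
move: (normc (s - s0)) (normc (w' - w)) (normc (2 * s0)) (normc_ge0 (s - s0)) D0 ss0 wd c2.
move=> n D m n0 D0 nD De cm.
apply: le_trans (_ : e * D * c <= _); last by rewrite ler_wpM2l// mulr_ge0// ltW.
rewrite -(ler_pM2r (exprn_gt0 2 c0)).
rewrite (_ : n * n * c ^+ 2 = (n * c) * (n * c)); last by ring.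
rewrite (_ : _ * c ^+ 2 = D * (e * c ^+ 3)); last by ring.
apply: ler_pM => //; first by rewrite mulr_ge0// ltW.
  by rewrite mulr_ge0// ltW.
by rewrite (le_trans nD)// ltW.
Qed.

Lemma Re_gt0_near1 w : normc (w - 1) < 1 -> 0 < complex.Re w.
Proof.
move=> /(le_lt_trans (Re_le_normc _)); case: w => a b /=.
by rewrite ltr_norml; lra.
Qed.

Lemma Re_gt0V w : 0 < complex.Re w -> 0 < complex.Re w^-1.
Proof.
by case: w => a b /= a0; rewrite divr_gt0// ltr_pwDl ?exprn_gt0// sqr_ge0.
Qed.

(** In the right half-plane $|w+1| \ge 1$. *)
Lemma normc_sub1_sqr w : 0 <= complex.Re w -> normc (w - 1) <= normc (w ^+ 2 - 1).
Proof.
move=> w0; rewrite (_ : w ^+ 2 - 1 = (w - 1) * (w + 1)); last by ring.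
rewrite normcM ler_peMr ?normc_ge0//.
apply: le_trans (Re_le_normc _); apply: le_trans (ler_norm _).
by case: w w0 => a b /=; rewrite lerDr.
Qed.

End square_root.

(** * Continuation of the square root as [q] moves *)

Section root_of_quotient.
Variables (R : realType) (K : set (Cplx R)) (z p : Cplx R) (r : R).
Implicit Types (q w : Cplx R) (s : Cplx R -> Cplx R).

(* [s] is the branch on [K] of the square root of [(w - p) / (w - q)] that extends to the
   value [1] at infinity. *)
Definition quotient_root q s : Prop :=
  [/\ forall w, K w -> derivable s w 1,
      forall w, K w -> s w ^+ 2 * (w - q) = w - p
    & forall w, K w -> 10 * r <= normc (w - z) -> 0 < complex.Re (s w)].

Lemma far_quotient q q' w : normc (q - z) < r -> normc (q' - z) < r ->
  10 * r <= normc (w - z) -> normc ((w - q') / (w - q) - 1) < 2 / 9.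
Proof.
move=> qr q'r wr.
have r0 : 0 < r by apply: le_lt_trans qr; exact: normc_ge0.
have wq : 9 * r < normc (w - q).
  have := normcD_le (w - q) (q - z); rewrite addrA subrK; lra.
have wq0 : w - q != 0.
  by apply: contraTneq wq => ->; rewrite normc0 -leNgt mulr_ge0// ltW.
rewrite (_ : _ - 1 = (q - q') / (w - q)); last by field.
rewrite normcM normcV ltr_pdivrMr ?normc_gt0//.
have := normcD_le (q - z) (z - q'); rewrite addrA subrK -(normcN (z - q')) opprB; lra.
Qed.

(** Dividing [s] by the principal root [t] of (w - q') / (w - q) replaces [q] by [q']. At far points
    [s] and [t] are both within 2/9 of 1, so $|s/t - 1| < (4/9)/(7/9) < 1$ and the real part stays
    positive. *)
Lemma quotient_root_step q q' s : normc (p - z) < r -> normc (q - z) < r ->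
  normc (q' - z) < r -> ~ K q -> ~ K q' ->
  (forall w, K w -> 0 < complex.Re ((w - q') / (w - q))) ->
  quotient_root q s -> exists s', quotient_root q' s'.
Proof.
move=> pr qr q'r Kq Kq' Req [ds sE sfar].
have wq0 w : K w -> w - q != 0 by move=> Kw; rewrite subr_eq0; apply: contraPneq Kw => ->.
have wq'0 w : K w -> w - q' != 0 by move=> Kw; rewrite subr_eq0; apply: contraPneq Kw => ->.
pose t w := csqrt ((w - q') / (w - q)).
have t0 w : K w -> t w != 0.
  move=> Kw; rewrite -(sqrf_eq0 (t w)) csqrtK.
  by rewrite mulf_neq0 ?invr_eq0 ?wq0 ?wq'0.
exists (fun w => s w / t w); split => w Kw.
- apply: derivableM; first exact: ds.
  apply: derivableV; first exact: t0.
  apply/derivable1_diffP; apply: differentiable_comp; apply/derivable1_diffP.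
    by apply: derivableM; [exact: derivableB|apply: derivableV; [exact: wq0|exact: derivableB]].
  by apply: derivable_csqrt; exact: Req.
- rewrite expr_div_n csqrtK -sE//; field.
  by rewrite wq0// wq'0.
- move=> wfar; apply: Re_gt0_near1.
  have tw : normc (t w - 1) < 2 / 9.
    apply: le_lt_trans (normc_sub1_sqr (Re_csqrt_ge0 _)) _.
    by rewrite csqrtK; exact: far_quotient.
  have sw : normc (s w - 1) < 2 / 9.
    apply: le_lt_trans (normc_sub1_sqr (ltW (sfar _ Kw wfar))) _.
    rewrite (_ : s w ^+ 2 = (w - p) / (w - q)); first exact: far_quotient.
    by rewrite -sE// mulfK ?wq0.
  have -> : s w / t w - 1 = ((s w - 1) - (t w - 1)) / t w by field; exact: t0.
  rewrite normcM normcV ltr_pdivrMr ?normc_gt0 ?t0// mul1r.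
  apply: le_lt_trans (normcD_le _ _) _; rewrite normcN.
  have := normcD_le (t w) (1 - t w); rewrite addrC subrK normc1 -(normcN (1 - _)) opprB; lra.
Qed.

(** If every reachable [q] stayed within r / 2 of [z], the set [U] of reachable points would be
    nonempty, open and relatively closed in the complement of [K]. It would then be the whole
    complement, which contains a point at distance at least [r]. *)
Lemma exists_quotient_root : compact K -> connected (~` K) -> ~ K p ->
  normc (p - z) < r -> (exists2 x, ~ K x & r <= normc (x - z)) ->
  exists q s, [/\ ~ K q, r / 2 <= normc (q - z) < r & quotient_root q s].
Proof.
move=> cK ccK Kp pr [x0 Kx0 x0r].
have r0 : 0 < r by apply: le_lt_trans pr; exact: normc_ge0.
apply: contrapT => none.
pose U := [set q | [/\ ~ K q, normc (q - z) < r & exists s, quotient_root q s]].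
have Usmall q : U q -> normc (q - z) < r / 2.
  move=> [Kq qr [s sq]]; rewrite ltNge; apply/negP => rq; apply: none.
  by exists q, s; rewrite rq.
have Up : U p.
  split=> //; exists (fun=> 1); split=> // w _; rewrite ?expr1n ?mul1r//=.
have opK : open (~` K) by apply: closed_openC; exact: compact_closed_Cplx.
(* Moving [q] by less than its distance to [K] keeps (w - q') / (w - q) and its inverse in the right
   half-plane. Reachability thus passes both ways, which yields openness and closedness together. *)
have ballK q : ~ K q -> normc (q - z) < r -> exists2 d : R, 0 < d & forall q', normc (q' - q) < d ->
    [/\ ~ K q', normc (q' - z) < r, U q -> U q' & U q' -> U q].
  move=> Kq qr.
  have /nbhs_normcP[d d0 dP] : nbhs q (~` K) by apply: open_nbhs_nbhs.
  exists (Num.min d (r - normc (q - z))); first by rewrite lt_min d0 subr_gt0.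
  move=> q'; rewrite lt_min => /andP[q'd q'r].
  have Kq' : ~ K q' by exact: dP.
  have q'z : normc (q' - z) < r.
    have := normcD_le (q' - q) (q - z); rewrite addrA subrK; lra.
  have wq0 w : K w -> w - q != 0 by move=> Kw; rewrite subr_eq0; apply: contraPneq Kw => ->.
  have Req w : K w -> 0 < complex.Re ((w - q') / (w - q)).
    move=> Kw; apply: Re_gt0_near1.
    rewrite (_ : _ - 1 = (q - q') / (w - q)); last by field; exact: wq0.
    rewrite normcM normcV ltr_pdivrMr ?normc_gt0 ?wq0// mul1r -normcN opprB.
    apply: lt_le_trans q'd _; rewrite leNgt; apply/negP => /dP; exact.
  split=> //.
    by move=> [_ _ [s sq]]; split=> //; apply: quotient_root_step sq.
  move=> [_ _ [s sq]]; split=> //; apply: quotient_root_step sq => // w Kw.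
  by rewrite -invf_div; apply: Re_gt0V; exact: Req.
have : U = ~` K.
  apply: ccK; first by exists p.
    exists U; last by rewrite setIidr// => q [].
    rewrite openE => q Uq; have [Kq qr _] := Uq.
    have [d d0 dP] := ballK q Kq qr.
    by apply/nbhs_normcP; exists d => // q' /dP[_ _ + _]; apply.
  exists (~` (~` K `\` U)).
    apply: open_closedC; rewrite openE => q [Kq nUq].
    have [qr|rq] := ltP (normc (q - z)) r.
      have [d d0 dP] := ballK q Kq qr.
      by apply/nbhs_normcP; exists d => // q' /dP[Kq' _ _ h]; split=> // /h.
    have /nbhs_normcP[d d0 dP] : nbhs q (~` K) by apply: open_nbhs_nbhs.
    apply/nbhs_normcP; exists (Num.min d (r / 2)); first by rewrite lt_min d0 divr_gt0.
    move=> q'; rewrite lt_min => /andP[q'd q'r]; split; first exact: dP.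
    move/Usmall; have := normcD_le (q - q') (q' - z).
    by rewrite addrA subrK -(normcN (q - q')) opprB; lra.
  apply/seteqP; split=> q; first by move=> Uq; split; [case: Uq|move=> []].
  by move=> [Kq h]; apply: contrapT => nU; apply: h.
move=> UK; have : U x0 by rewrite UK.
by move=> [_ + _]; rewrite ltNge x0r.
Qed.

End root_of_quotient.

(** * Boundary points *)

Section boundary_point.
Variables (R : realType) (K : set (Cplx R)).
Implicit Types (z w p q : Cplx R).

(** The sup norm of the identity bounds [K]; a large positive real number lies beyond it. *)
Lemma exists_far_point z (r : R) : compact K -> exists2 x, ~ K x & r <= normc (x - z).
Proof.
move=> cK.
have cid : {within K, continuous (@id (Cplx R))} by apply: continuous_subspaceT => w; exact: cvg_id.
pose M := sup_norm K id; pose a := `|M| + `|r| + normc z + 1.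
have a0 : 0 < a by rewrite /a; have := normc_ge0 z; have := normr_ge0 M; have := normr_ge0 r; lra.
have nx : normc (pt a 0) = a.
  by rewrite /= expr0n addr0 sqrtr_sqr gtr0_norm.
exists (pt a 0).
  move=> /(normc_le_sup_norm cK cid); rewrite nx -/M /a.
  have := normc_ge0 z; have := ler_norm M; have := normr_ge0 r; lra.
have := normcD_le (pt a 0 - z) z; rewrite subrK nx /a.
have := normr_ge0 M; have := ler_norm r; lra.
Qed.

(** * Estimates at a single point [w], with [s] the value of the root there *)

Section estimates.
Variables (z p q w s : Cplx R) (r : R).
Hypotheses (pz : normc (p - z) < r / 4) (rqz : r / 2 <= normc (q - z)) (qzr : normc (q - z) < r).
Hypotheses (wq : w != q) (sE : s ^+ 2 * (w - q) = w - p).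
Hypothesis (sfar : 10 * r <= normc (w - z) -> 0 < complex.Re s).

(** This form suits far points, where [s] is near 1. Near [z] the bound comes from the form with
    [p - q] in the denominator. *)
Let unit_value : Cplx R := 4 * (w - z) / ((w - q) * (1 + s) ^+ 2).

Let r0 : 0 < r. Proof. by apply: le_lt_trans qzr; exact: normc_ge0. Qed.

Let wq0 : w - q != 0. Proof. by rewrite subr_eq0. Qed.

Let pqE : (1 - s) * (1 + s) * (w - q) = p - q.
Proof.
rewrite (_ : _ * (w - q) = (w - q) - s ^+ 2 * (w - q)); last by ring.
by rewrite sE; ring.
Qed.

Let pq_ge : r / 4 <= normc (p - q).
Proof.
have := normcD_le (q - p) (p - z); rewrite addrA subrK -(normcN (q - p)) opprB.
by move: pz rqz; lra.
Qed.

Let pq_le : normc (p - q) <= 5 / 4 * r.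
Proof.
have := normcD_le (p - z) (z - q); rewrite addrA subrK -(normcN (z - q)) opprB.
by move: pz qzr; lra.
Qed.

Let wz_le : normc (w - z) <= normc (w - q) + r.
Proof. have := normcD_le (w - q) (q - z); rewrite addrA subrK; move: qzr; lra. Qed.

Let one_add_far : 10 * r <= normc (w - z) -> 1 <= normc (1 + s).
Proof.
move=> /sfar s0; apply: le_trans (Re_le_normc _); apply: le_trans (ler_norm _).
by case: (s) s0 => a b /=; rewrite lerDl => /ltW.
Qed.

Let one_sub_le : normc (1 - s) <= 2 + normc (1 + s).
Proof.
rewrite (_ : 1 - s = 2 + - (1 + s)); last by ring.
by rewrite (le_trans (normcD_le _ _))// normcN normc_nat.
Qed.

(** Otherwise $|1-s| \le 3$ and $r/4 \le |p-q| \le |w-q|/44$, so $|w-q| \ge 11r$ and $|w-z| \ge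
    10r$. There $\mathrm{Re}\,s > 0$, which forces $|1+s| \ge 1$. *)
Let one_add_ge : 1 / 132 <= normc (1 + s).
Proof.
rewrite leNgt; apply/negP => small.
have wq_ge : 11 * r <= normc (w - q).
  have : normc (1 - s) * normc (1 + s) <= 3 * (1 / 132).
    by rewrite ler_pM ?normc_ge0// ?(ltW small)// (le_trans one_sub_le)//; move: small; lra.
  move=> /(ler_wpM2r (normc_ge0 (w - q))); rewrite -!normcM pqE.
  by move: pq_ge; lra.
suff : 1 <= normc (1 + s) by move: small; lra.
apply: one_add_far.
have := normcD_le (w - z) (z - q); rewrite addrA subrK -(normcN (z - q)) opprB.
by move: wq_ge qzr; lra.
Qed.

Lemma one_add_neq0 : 1 + s != 0.
Proof.
by apply: contraTneq one_add_ge => ->; rewrite normc0 -ltNge divr_gt0.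
Qed.

Lemma normc_unit_value_le : normc unit_value <= 40 * (4 * 265).
Proof.
have s10 : 0 < normc (1 + s) by apply: lt_le_trans one_add_ge; rewrite divr_gt0.
have s1 := one_add_neq0.
have [far|near_] := leP (10 * r) (normc (w - z)).
  rewrite /unit_value !normcM normcV !normcM normc_nat.
  have m1 := one_add_far far.
  have wq9 : 9 / 10 * normc (w - z) <= normc (w - q) by move: wz_le far; lra.
  rewrite ler_pdivrMr ?mulr_gt0 ?normc_gt0//.
  have : normc (w - q) <= normc (w - q) * (normc (1 + s) * normc (1 + s)).
    by rewrite ler_peMr ?normc_ge0// mulr_ege1.
  by move: wq9 (normc_ge0 (w - q)); lra.
have pq0 : 0 < normc (p - q) by apply: lt_le_trans pq_ge; rewrite divr_gt0.
have pq1 : p - q != 0 by apply: contraTneq pq0 => ->; rewrite normc0 ltxx.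
have -> : unit_value = 4 * (w - z) * (1 - s) / ((p - q) * (1 + s)).
  have s1' : 1 - s != 0.
    by apply: contraNneq pq1 => s1'; rewrite -pqE s1' !mul0r.
  by rewrite /unit_value -pqE; field; rewrite s1 wq0 s1'.
rewrite !normcM normcV normcM normc_nat.
rewrite ler_pdivrMr ?mulr_gt0//.
(* The constant is 265 = 2 * 132 + 1; the factors 40 and 4 of the bound come from $4|w-z| \le 40r$
   and $|p-q| \ge r/4$. *)
have h1 : normc (1 - s) <= 265 * normc (1 + s) by move: one_sub_le one_add_ge; lra.
apply: le_trans (_ : 4 * (10 * r) * (265 * normc (1 + s)) <= _).
  by rewrite ler_pM ?normc_ge0 ?mulr_ge0 ?normc_ge0// ler_pM2l// ltW.
have := ler_wpM2r (ltW s10) pq_ge; lra.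
Qed.

Lemma unit_value_far : 10 * r <= normc (w - z) ->
  normc (unit_value - 1) <= 10 * r / normc (w - z).
Proof.
move=> far; have m1 := one_add_far far.
have s10 : 0 < normc (1 + s) by apply: lt_le_trans m1.
have s1 := one_add_neq0.
have d0 : 0 < normc (w - z) by apply: lt_le_trans far; rewrite mulr_gt0.
have wq9 : 9 / 10 * normc (w - z) <= normc (w - q) by move: wz_le far; lra.
have rho_le (c : R) : 0 <= c -> c * r / normc (w - q) <= 10 / 9 * c * (r / normc (w - z)).
  move=> c0; rewrite ler_pdivrMr ?normc_gt0//.
  rewrite -[X in c * X](divfK (lt0r_neq0 d0)); set rho := r / _.
  have rho0 : 0 <= rho by rewrite divr_ge0 ?normc_ge0// ltW.
  have := ler_wpM2l (mulr_ge0 c0 rho0) wq9; lra.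
(* Both factors are 1 + O(r / |w - z|): [A] because [q] is close to [z], [B] because $|1-s| \le
   |1-s^2| = |p-q|/|w-q|$. *)
set A := (w - z) / (w - q); set B := 4 / (1 + s) ^+ 2.
have -> : unit_value - 1 = A * (B - 1) + (A - 1).
  by rewrite /unit_value /A /B; field; rewrite wq0 s1.
have A1 : normc (A - 1) <= 10 / 9 * (r / normc (w - z)).
  rewrite (_ : A - 1 = (q - z) / (w - q)); last by rewrite /A; field.
  rewrite normcM normcV; apply: le_trans (_ : 1 * r / normc (w - q) <= _).
    by rewrite mul1r ler_wpM2r ?invr_ge0 ?normc_ge0// ltW.
  by apply: le_trans (rho_le _ ler01) _; rewrite mulr1.
have A2 : normc A <= 10 / 9.
  by rewrite normcM normcV ler_pdivrMr ?normc_gt0//; move: wq9; lra.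
have ns : normc (1 - s) <= 25 / 18 * (r / normc (w - z)).
  rewrite -normcN opprB; apply: le_trans (normc_sub1_sqr (ltW (sfar far))) _.
  rewrite (_ : s ^+ 2 - 1 = - ((p - q) / (w - q))); last by rewrite -pqE; field.
  rewrite normcN normcM normcV; apply: le_trans (_ : 5 / 4 * r / normc (w - q) <= _).
    by rewrite ler_wpM2r ?invr_ge0 ?normc_ge0 ?pq_le.
  apply: le_trans (rho_le _ _) _; first lra.
  by rewrite le_eqVlt; apply/orP; left; apply/eqP; field; rewrite gt_eqF.
have B1 : normc (B - 1) <= 3 * normc (1 - s).
  rewrite (_ : B - 1 = (1 - s) * ((2 + (1 + s)) / (1 + s) ^+ 2)); last by rewrite /B; field.
  rewrite normcM mulrC ler_wpM2r ?normc_ge0// normcM normcV expr2 normcM.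
  rewrite ler_pdivrMr ?mulr_gt0//; apply: le_trans (normcD_le _ _) _.
  by rewrite normc_nat; move: (normc (1 + s)) m1 => m; nra.
apply: le_trans (normcD_le _ _) _; rewrite normcM.
have : normc A * normc (B - 1) <= 10 / 9 * (3 * (25 / 18 * (r / normc (w - z)))).
  by rewrite ler_pM ?normc_ge0// (le_trans B1)// ler_pM2l.
have : 0 <= r / normc (w - z) by rewrite divr_ge0 ?normc_ge0// ltW.
rewrite -(mulrA 10); move: A1; lra.
Qed.

End estimates.

End boundary_point.

(** * Construction of the bounded approximate identity *)

Section approximate_identity.
Variables (R : realType) (K : set (Cplx R)).
Implicit Types (z w p q : Cplx R).

Lemma derivable_unit_value z q w (s : Cplx R -> Cplx R) : w != q -> 1 + s w != 0 ->
  derivable s w 1 -> derivable (fun v => 4 * (v - z) / ((v - q) * (1 + s v) ^+ 2)) w 1.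
Proof.
move=> wq s1 ds.
have dB (a : Cplx R) : derivable (fun v : Cplx R => v - a) w 1.
  by apply: derivableB; [exact: derivable_id|exact: derivable_cst].
apply: derivableM; first by apply: derivableM; [exact: derivable_cst|exact: dB].
apply: derivableV; first by rewrite mulf_neq0 ?expf_neq0// subr_eq0.
apply: derivableM; first exact: dB.
apply (@derivableX _ _ (fun v => 1 + s v) 2).
by apply: derivableD; [exact: derivable_cst|exact ds].
Qed.

Lemma approximate_unit z (r : R) : compact K -> connected (~` K) -> boundary K z -> 0 < r ->
  exists e, [/\ vanishing_ideal K z e,
    forall w, K w -> normc (e w) <= 40 * (4 * 265)
  & forall w, K w -> 10 * r <= normc (w - z) -> normc (e w - 1) <= 10 * r / normc (w - z)].
Proof.
move=> cK ccK [clz intz] r0.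
have Kz : K z by rewrite (closure_id K).1//; exact: compact_closed_Cplx.
(* Since [z] is not interior, every disc about it meets the complement. *)
have [p Kp pz] : exists2 p, ~ K p & normc (p - z) < r / 4.
  apply: contrapT => none; apply: intz; apply/nbhs_normcP.
  exists (r / 4) => [|w wz]; first by rewrite divr_gt0.
  by apply: contrapT => Kw; apply: none; exists w.
have pr : normc (p - z) < r by apply: lt_trans pz _; lra.
have [q [s [Kq /andP[rq qr] [ds sE sfar]]]] :=
  exists_quotient_root cK ccK Kp pr (exists_far_point z r cK).
have wq w : K w -> w != q by apply: contraPneq => ->.
pose f w := 4 * (w - z) / ((w - q) * (1 + s w) ^+ 2).
have df w : K w -> derivable f w 1.
  move=> Kw; have s1 := one_add_neq0 pz rq qr (sE _ Kw) (sfar _ Kw).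
  exact: derivable_unit_value (wq _ Kw) s1 (ds _ Kw).
exists (patch (fun=> 0) K f); split.
- split; first exact: patch_uniform_algebra.
  by rewrite patchT ?inE// /f subrr mulr0 mul0r.
- move=> w Kw; rewrite patchT ?inE//.
  exact: (normc_unit_value_le pz rq qr (wq _ Kw) (sE _ Kw) (sfar _ Kw)).
- move=> w Kw far; rewrite patchT ?inE//.
  exact: (unit_value_far pz rq qr (wq _ Kw) (sE _ Kw) (sfar _ Kw) far).
Qed.

(** The sequence uses r = 1 / (n + 1). Near [z], [x] is small and the [e i] are uniformly bounded;
    away from [z], [x] is bounded and [e i] is close to 1. *)
Lemma boundary_bai z : compact K -> connected (~` K) -> boundary K z ->
  has_bounded_approximate_identity (sup_norm K) (vanishing_ideal K z).
Proof.
move=> cK ccK bz.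
have Kz : K z by case: bz => + _; rewrite -(closure_id K).1//; exact: compact_closed_Cplx.
have rn (n : nat) : 0 < n.+1%:R^-1 :> R by rewrite invr_gt0 ltr0n.
have [e eP] := choice (fun n => approximate_unit cK ccK bz (rn n)).
move: eP; set C := 40 * (4 * 265) => eP.
have C0 : 0 < C by rewrite !mulr_gt0// ltr0n.
exists nat, (fun i j => (i <= j)%N), e; split.
- split; [exact: inhabits 0%N|exact: leqnn|by move=> i j k; exact: leq_trans|].
  by move=> i j; exists (maxn i j); rewrite leq_maxl leq_maxr.
- by move=> i; case: (eP i).
- by exists C => // i; apply: sup_norm_le; [exists z|case: (eP i)].
move=> x [[cx _ _] xz] eps eps0.
have C1 : 0 < C + 1 by rewrite addr_gt0.
have [|d d0 dP] := (within_normcP K x).1 cx z Kz (eps / (2 * (C + 1))).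
  by rewrite divr_gt0// mulr_gt0.
pose B := sup_norm K x.
have xB w : K w -> normc (x w) <= B by exact: normc_le_sup_norm.
have B0 : 0 <= B by apply: le_trans (xB z Kz); exact: normc_ge0.
(* The first bound gives $10r \le d$, so the far estimate holds outside the disc of radius [d]; the
   second makes the product there at most eps / 2. Using [B + 1] keeps the denominator positive when
   [B] is 0. *)
pose m := Num.min (d / 10) (eps * d / (20 * (B + 1))).
have m0 : 0 < m by rewrite lt_min !divr_gt0 ?mulr_gt0// ltr_wpDl.
exists (Num.bound m^-1) => i im.
set r : R := i.+1%:R^-1.
have rm : r <= m.
  rewrite /r invf_ple ?posrE//; apply: le_trans (ltW (archi_boundP _)) _.
    by rewrite invr_ge0 ltW.
  by rewrite ler_nat (leq_trans im).
have rd : 10 * r <= d by move: rm; rewrite le_min => /andP[]; lra.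
have rB : B * (10 * r) <= eps / 2 * d.
  have : r <= eps * d / (20 * (B + 1)) by move: rm; rewrite le_min => /andP[].
  rewrite ler_pdivlMr ?mulr_gt0 ?ltr_wpDl//.
  have : 0 < r by exact: rn.
  lra.
have [_ eC efar] := eP i.
apply: le_lt_trans (_ : eps / 2 < eps); last by rewrite ltr_pdivrMr// ltr_pMr// ltr1n.
apply: sup_norm_le => [|w Kw]; first by exists z.
rewrite !fctE (_ : x w * e i w - x w = x w * (e i w - 1)); last by ring.
rewrite normcM; have [wd|dw] := ltP (normc (w - z)) d.
  have := dP w Kw wd; rewrite xz subr0 => xw.
  apply: le_trans (_ : eps / (2 * (C + 1)) * (C + 1) <= _); last first.
    by rewrite le_eqVlt; apply/orP; left; apply/eqP; field; rewrite gt_eqF.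
  rewrite ler_pM ?normc_ge0 ?(ltW xw)// (le_trans (normcD_le _ _))// normcN normc1 lerD2r.
  exact: eC.
have wz0 : 0 < normc (w - z) by apply: lt_le_trans dw.
apply: le_trans (_ : B * (10 * r / normc (w - z)) <= _).
  by rewrite ler_pM ?normc_ge0 ?xB// efar// (le_trans rd).
rewrite mulrA ler_pdivrMr//; apply: le_trans rB _.
by rewrite ler_pM2l// divr_gt0.
Qed.

End approximate_identity.

Theorem theorem9p3 (R : realType) (K : set (Cplx R))
    (compactK : compact K) (connectedCK : connected (~` K)) :
  [set z | K z /\
     has_bounded_approximate_identity (sup_norm K) (vanishing_ideal K z)]
  = boundary K.
Proof.
apply/seteqP; split=> z.
  move=> [Kz bai]; split; first exact: subset_closure.
  by move=> /(interior_no_bai compactK); exact.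
move=> bz; split; last exact: boundary_bai.
by case: bz => + _; rewrite -(closure_id K).1//; exact: compact_closed_Cplx.
Qed.
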